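(* Let $\mathcal{H}$ be a real separable Hilbert space and let $A\in\mathcal{L}(\mathcal{H})$ be an isomorphism (bounded, linear, bijective, with bounded inverse). Then the following statements are equivalent: (i) There is a Riesz basis $\{f_n : n\in\mathbb{N}\}$ of $\mathcal{H}$ such that the family $\{f_n+iAf_n : n\in\mathbb{N}\}$ is a Riesz basis of the complex Hilbert space $\mathcal{H}+i\mathcal{H}$. (ii) For every Riesz basis $\{f_n : n\in\mathbb{N}\}$ of $\mathcal{H}$, the family $\{f_n+iAf_n : n\in\mathbb{N}\}$ is a Riesz basis of $\mathcal{H}+i\mathcal{H}$. (iii) $i\in\rho(A)$, i.e. $i$ is not an element of the spectrum of $A$. (iv) $-i\in\rho(A^* )$.
   Context: $\mathcal{H}+i\mathcal{H}$ is the complexification of the real Hilbert space $\mathcal{H}$: the complex Hilbert space of all $f_r+if_i$ with $f_r,f_i\in\mathcal{H}$ and inner product $\langle f_r+if_i,g_r+ig_i\rangle=\langle f_r,g_r\rangle_{\mathcal{H}}+\langle f_i,g_i\rangle_{\mathcal{H}}+i(\langle f_i,g_r\rangle_{\mathcal{H}}-\langle f_r,g_i\rangle_{\mathcal{H}})$. $\mathcal{L}(\mathcal{H})$ is the space of bounded linear operators $\mathcal{H}\to\mathcal{H}$; such an operator acts on $\mathcal{H}+i\mathcal{H}$ by $A(f_r+if_i)=Af_r+iAf_i$, and its spectrum $\sigma(A)$ and resolvent set $\rho(A)=\mathbb{C}\setminus\sigma(A)$ are those of this complex-linear extension; $A^*$ is the adjoint. A family $\{f_n : n\in\mathbb{N}\}$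 in a real or complex Hilbert space $X$ is a Riesz basis of $X$ if there are an orthonormal basis $\{e_n : n\in\mathbb{N}\}$ of $X$ and a bounded linear bijection $U:X\to X$ with bounded inverse such that $f_n=Ue_n$ for all $n$. If $\mathcal{H}$ is finite-dimensional, the index set $\mathbb{N}$ is to be replaced by $\{1,\dots,\dim\mathcal{H}\}$, so that Riesz bases are ordinary vector space bases. *)

(* Defs.v *)
From HB Require Import structures.
From mathcomp Require Import all_boot all_order all_algebra.
From mathcomp Require Import complex.
From mathcomp Require Import all_classical all_reals all_analysis.
From mathcomp Require Import ring lra.

Set Implicit Arguments.
Unset Strict Implicit.
Unset Printing Implicit Defensive.

Import Order.TTheory GRing.Theory Num.Theory.
Import numFieldNormedType.Exports.

Local Open Scope classical_set_scope.
Local Open Scope ring_scope.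

(* The inner product is linear in its first argument and theta-semilinear in
   the second; theta is idfun for real and conjc for complex Hilbert spaces. *)
HB.mixin Record isHilbert (K : numFieldType) (theta : K -> K) X
    & CompleteNormedModule K X := {
  inner : {dot X for theta};
  innerxx : forall x : X, inner x x = `|x| ^+ 2
}.

#[short(type="hilbertType")]
HB.structure Definition Hilbert (K : numFieldType) (theta : K -> K) :=
  {X of CompleteNormedModule K X & isHilbert K theta X}.

Notation realHilbertType R := (hilbertType (@idfun R)).

Definition separable_space (T : topologicalType) : Prop :=
  exists2 S : set T, countable S & dense S.

Section Operators.
Context (K : numFieldType).

Definition bounded_operator (X Y : normedModType K) (T : X -> Y) : Prop :=
  linear T /\ exists M : K, forall x, `|T x| <= M * `|x|.

Definition isomorphism (X Y : normedModType K) (T : X -> Y) : Prop :=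
  bounded_operator T /\
  exists S : Y -> X, [/\ bounded_operator S, cancel T S & cancel S T].

Definition spectrum (X : normedModType K) (T : X -> X) : set K :=
  [set l | ~ isomorphism (fun x => l *: x - T x)].

Definition resolvent_set (X : normedModType K) (T : X -> X) : set K :=
  ~` spectrum T.

End Operators.

(* For a bounded operator T, the vector z below exists for every y by the
   Riesz representation theorem, and it is unique; the default is never used. *)
Definition adjoint (K : numFieldType) (theta : K -> K) (X : hilbertType theta)
    (T : X -> X) (y : X) : X :=
  xget 0 [set z | forall x, inner (T x) y = inner x z].

Section RieszBases.
Context (K : numFieldType).

Definition has_dim (X : lmodType K) (n : nat) : Prop :=
  inhabited (Vector.axiom n X).

(* All of nat if X is infinite-dimensional, {0, ..., dim X - 1} otherwise. *)
Definition index_set (X : lmodType K) : set nat :=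
  [set k | forall n, has_dim X n -> (k < n)%N].

Definition linear_span (X : lmodType K) (S : set X) : set X :=
  [set x | exists n (c : 'I_n -> K) (v : 'I_n -> X),
     (forall i, S (v i)) /\ x = \sum_(i < n) c i *: v i].

Context (theta : K -> K) (X : hilbertType theta).

(* In the next two definitions a family indexed by D is a function on nat whose
   values outside D are irrelevant. *)
Definition orthonormal_basis (D : set nat) (e : nat -> X) : Prop :=
  (forall m n, D m -> D n -> inner (e m) (e n) = (m == n)%:R) /\
  dense (linear_span (e @` D)).

Definition riesz_basis (D : set nat) (f : nat -> X) : Prop :=
  exists (e : nat -> X) (U : X -> X),
    [/\ orthonormal_basis D e, isomorphism U & forall n, D n -> f n = U (e n)].

End RieszBases.

(* The pair (x, y) stands for x + iy. *)
Definition complexification (V : Type) : Type := (V * V)%type.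

Definition cplx (V : Type) (x y : V) : complexification V := (x, y).

Definition complex_extension (V : Type) (A : V -> V) (z : complexification V) :
  complexification V := cplx (A z.1) (A z.2).

HB.instance Definition _ (V : zmodType) :=
  GRing.Zmodule.copy (complexification V) (V * V)%type.

Section ComplexificationLmodule.
Context (R : realType) (V : lmodType R).
Local Notation VC := (complexification V).

Definition cplx_scale (c : R[i]) (z : VC) : VC :=
  cplx (complex.Re c *: z.1 - complex.Im c *: z.2)
       (complex.Re c *: z.2 + complex.Im c *: z.1).

Let cscaleA a b v : cplx_scale a (cplx_scale b v) = cplx_scale (a * b) v.
Proof.
case: a b v => [a a'] [b b'] [x y]; rewrite /cplx_scale /cplx /=.
rewrite !scalerBr !scalerDr !scalerBl !scalerDl !scalerA !opprD.
by congr (_, _); rewrite -!addrA; congr (_ + _); rewrite [RHS]addrC -!addrA.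
Qed.

Let cscale1 : left_id 1 cplx_scale.
Proof.
by case=> x y; rewrite /cplx_scale /cplx /= !scale1r !scale0r subr0 addr0.
Qed.

Let cscaleDr : right_distributive cplx_scale +%R.
Proof.
move=> [a a'] [x y] [x' y']; rewrite /cplx_scale /cplx /=; congr (_, _) => /=.
  by rewrite !scalerDr opprD addrACA.
by rewrite !scalerDr addrACA.
Qed.

Let cscaleDl v : {morph cplx_scale^~ v : a b / a + b}.
Proof.
case: v => x y [a a'] [b b']; rewrite /cplx_scale /cplx /=; congr (_, _) => /=.
  by rewrite !scalerDl opprD addrACA.
by rewrite !scalerDl addrACA.
Qed.

HB.instance Definition _ := GRing.Zmodule_isLmodule.Build R[i] VC
  cscaleA cscale1 cscaleDr cscaleDl.

End ComplexificationLmodule.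

Section ComplexificationHilbert.
Context (R : realType) (H : realHilbertType R).
Local Notation HC := (complexification H).
Implicit Types z w : HC.

Definition cplx_inner z w : R[i] :=
  Complex (inner z.1 w.1 + inner z.2 w.2) (inner z.2 w.1 - inner z.1 w.2).

Definition cplx_norm z : R[i] := (Num.sqrt (`|z.1| ^+ 2 + `|z.2| ^+ 2))%:C%C.

Let inner_sym (x y : H) : inner x y = inner y x.
Proof. by rewrite hermC expr0 mul1r. Qed.

Let cinner_zmodl w : zmod_morphism (cplx_inner ^~ w).
Proof.
move=> u v; rewrite /cplx_inner /= !linearBl /=.
by apply/eqP; rewrite eq_complex /=; apply/andP; split; apply/eqP; ring.
Qed.

Let cinner_zmodr z : zmod_morphism (cplx_inner z).
Proof.
move=> u v; rewrite /cplx_inner /= !linearBr /=.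
by apply/eqP; rewrite eq_complex /=; apply/andP; split; apply/eqP; ring.
Qed.

Let cinner_scalel w : scalable_for *%R (cplx_inner ^~ w).
Proof.
move=> [a b] u; rewrite /cplx_inner /= !linearDl /= !linearNl !linearZl_LR /=.
by apply/eqP; rewrite eq_complex /=; apply/andP; split; apply/eqP; ring.
Qed.

Let cinner_scaler z : scalable_for (@conjc R \; *%R) (cplx_inner z).
Proof.
move=> [a b] u; rewrite /cplx_inner /= !linearDr /= !linearNr !linearZr_LR /=.
by apply/eqP; rewrite eq_complex /=; apply/andP; split; apply/eqP; ring.
Qed.

HB.instance Definition _ := isBilinear.Build R[i] HC HC R[i]
  *%R (@conjc R \; *%R) cplx_inner
  cinner_zmodl cinner_zmodr cinner_scalel cinner_scaler.

Let cinner_herm z w : cplx_inner z w = (-1) ^+ false * (cplx_inner w z)^*%C.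
Proof.
rewrite expr0 mul1r /cplx_inner /=; apply/eqP; rewrite eq_complex /=.
by rewrite opprB !(inner_sym w.1) !(inner_sym w.2) !eqxx.
Qed.

HB.instance Definition _ := isHermitianSesquilinear.Build R[i] HC false
  (@conjc R) cplx_inner cinner_herm.

Let cinnerxx z : cplx_inner z z = cplx_norm z ^+ 2.
Proof.
rewrite /cplx_norm -rmorphXn sqr_sqrtr ?addr_ge0 ?sqr_ge0//.
by rewrite /cplx_inner !innerxx (inner_sym z.2) subrr.
Qed.

Let cnorm_eq0 z : cplx_norm z = 0 -> z = 0.
Proof.
case: z => x y [] /eqP; rewrite sqrtr_eq0 /= => le0.
have {le0} : `|x| ^+ 2 + `|y| ^+ 2 == 0.
  by rewrite eq_le le0 addr_ge0 ?sqr_ge0.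
rewrite paddr_eq0 ?sqr_ge0// !expf_eq0 /= !normr_eq0.
by move=> /andP[/eqP -> /eqP ->].
Qed.

Let cinner_gt0 z : z != 0 -> 0 < cplx_inner z z.
Proof.
move=> z0; rewrite cinnerxx exprn_gt0// lt_neqAle eq_sym.
by rewrite (contra_neq (@cnorm_eq0 z) z0) /= lecR sqrtr_ge0.
Qed.

HB.instance Definition _ := isDotProduct.Build R[i] HC cplx_inner cinner_gt0.

Let cnormE z : cplx_norm z = `|Complex `|z.1| `|z.2| |.
Proof. by rewrite normc_def. Qed.

Let cnormD z w : cplx_norm (z + w) <= cplx_norm z + cplx_norm w.
Proof.
rewrite [in leRHS]cnormE [in leRHS]cnormE; apply: le_trans (ler_normD _ _).
rewrite normc_def /cplx_norm lecR ler_sqrt ?addr_ge0 ?sqr_ge0//=.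
by rewrite lerD// ler_pXn2r ?nnegrE ?addr_ge0// ler_normD.
Qed.

Let cnormZ c z : cplx_norm (c *: z) = `|c| * cplx_norm z.
Proof.
apply/eqP; rewrite -(@eqrXn2 _ 2)//; last 2 first.
- by rewrite lecR sqrtr_ge0.
- by rewrite mulr_ge0// lecR sqrtr_ge0.
rewrite exprMn -!cinnerxx; apply/eqP.
rewrite linearZl_LR linearZr_LR /= mulrA; congr (_ * _).
by rewrite sqr_normc.
Qed.

HB.instance Definition _ := Lmodule_isNormed.Build R[i] HC
  cnormD cnormZ cnorm_eq0.

Let normE z : `|z| = cplx_norm z. Proof. by []. Qed.

Let proj_le z (r : R) : `|z| < r%:C%C -> `|z.1| < r /\ `|z.2| < r.
Proof.
rewrite normE /cplx_norm ltcR => zr; split; apply: le_lt_trans zr;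
  by rewrite -[leLHS]normr_id -sqrtr_sqr ler_wsqrtr// ?lerDl ?lerDr sqr_ge0.
Qed.

Let complexification_complete (F : set_system HC) :
  ProperFilter F -> cauchy F -> cvg F.
Proof.
move=> FF /cauchy_ballP Fc.
have cp (p : HC -> H) : (forall z w, p (z - w) = p z - p w) ->
    (forall z (r : R), `|z| < r%:C%C -> `|p z| < r) -> cvg (p @ F).
  move=> pB ple; apply: cauchy_cvg; apply/cauchy_ballP => e e0.
  rewrite near_map2.
  have e0' : 0 < e%:C%C by rewrite ltcR.
  apply: filterS (Fc _ e0') => -[z w]; rewrite -!ball_normE /= => zwe.
  by rewrite -pB; exact: ple.
have /cvgrPdist_lt c1 : cvg ((fun z : HC => z.1) @ F).
  by apply: cp => // z r /proj_le[].
have /cvgrPdist_lt c2 : cvg ((fun z : HC => z.2) @ F).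
  by apply: cp => // z r /proj_le[].
apply/cvg_ex; exists (cplx (lim ((fun z : HC => z.1) @ F))
                           (lim ((fun z : HC => z.2) @ F))).
apply/cvgrPdist_lt => -[e e'] /=; rewrite ltcE /= => /andP[/eqP -> e0].
have h0 : 0 < e / 2 by rewrite divr_gt0.
near=> z.
have z1 : `|lim ((fun z : HC => z.1) @ F) - z.1| < e / 2.
  by near: z; exact: c1.
have z2 : `|lim ((fun z : HC => z.2) @ F) - z.2| < e / 2.
  by near: z; exact: c2.
rewrite normE /cplx_norm /= ltcR -[ltRHS]gtr0_norm// -sqrtr_sqr ltr_sqrt ?exprn_gt0//.
apply: (@lt_le_trans _ _ ((e / 2) ^+ 2 + (e / 2) ^+ 2)).
  by apply: ltrD; rewrite ltr_pXn2r// nnegrE// ltW.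
by have := sqr_ge0 e; nra.
Unshelve. all: by end_near. Qed.

HB.instance Definition _ := Uniform_isComplete.Build HC
  complexification_complete.

Let cinner_norm z : (cplx_inner : {dot HC for @conjc R}) z z = `|z| ^+ 2.
Proof. exact: cinnerxx. Qed.

HB.instance Definition _ := isHilbert.Build R[i] (@conjc R) HC cinner_norm.

End ComplexificationHilbert.

(* Main.v *)
Require Import Defs.
From mathcomp Require Import all_boot all_order all_algebra.
From mathcomp Require Import complex.
From mathcomp Require Import all_classical all_reals all_analysis.
From mathcomp Require Import ring lra.

(* Put T = 1 + iA on the complexification H + iH, so that f_n + i A f_n = T f_n
   and T = -i (i - A) is an isomorphism iff i is in the resolvent set of A.
   If f_n = U e_n with e orthonormal, then e is also an orthonormal basis of
   H + iH and f_n + i A f_n = T U e_n; hence (iii) gives (ii).  Conversely, if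
   T U e_n = W e'_n with e' orthonormal, then W^-1 T U maps one orthonormal
   basis to another, so it is isometric with dense, hence full, range, and T is
   an isomorphism.  Orthonormal bases of H exist by Gram-Schmidt.  Finally
   (i - A)(-i - A) = 1 + A^2, so that i, and likewise -i, is in the resolvent
   set of A iff the real operator 1 + A^2 is an isomorphism, a condition
   invariant under passing to the adjoint. *)

Set Implicit Arguments.
Unset Strict Implicit.
Unset Printing Implicit Defensive.

Import Order.TTheory GRing.Theory Num.Theory.
Import numFieldNormedType.Exports.

Local Open Scope classical_set_scope.
Local Open Scope ring_scope.

(** * Bounded operators, isomorphisms and isometries of normed spaces *)

Section NormedSpaces.
Context {K : numFieldType}.
Implicit Types X Y Z : normedModType K.

Lemma denseP X (S : set X) :
  dense S <-> forall x e, 0 < e -> exists2 y, S y & `|x - y| < e.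
Proof.
split=> [dS x e e0|dS O [x Ox] oO].
  have [|y [xy Sy]] := dS (ball x e) _ (ball_open x e).
    by exists x; exact: ballxx.
  by exists y => //; move: xy; rewrite -ball_normE.
have /nbhs_ballP[e /= e0 xO] : nbhs x O by apply: open_nbhs_nbhs; split.
have [y Sy xy] := dS x e e0.
by exists y; split=> //; apply: xO; rewrite -ball_normE.
Qed.

Section LinearMap.
Context {X Y : normedModType K} {T : X -> Y}.

Lemma linear_apD (lT : linear T) x y : T (x + y) = T x + T y.
Proof. by rewrite -[x in LHS]scale1r lT scale1r. Qed.

Lemma linear_ap0 (lT : linear T) : T 0 = 0.
Proof. by apply: (addIr (T 0)); rewrite add0r -linear_apD// addr0. Qed.

Lemma linear_apZ (lT : linear T) a x : T (a *: x) = a *: T x.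
Proof. by rewrite -[a *: x]addr0 lT linear_ap0// addr0. Qed.

Lemma linear_apN (lT : linear T) x : T (- x) = - T x.
Proof. by rewrite -scaleN1r linear_apZ// scaleN1r. Qed.

Lemma linear_apB (lT : linear T) x y : T (x - y) = T x - T y.
Proof. by rewrite linear_apD// linear_apN. Qed.

Lemma linear_ap_sum (lT : linear T) n (c : 'I_n -> K) (v : 'I_n -> X) :
  T (\sum_(i < n) c i *: v i) = \sum_(i < n) c i *: T (v i).
Proof.
elim/big_ind2 : _ => [|x1 x2 y1 y2 <- <-|i _]; first exact: linear_ap0.
  by rewrite linear_apD.
by rewrite linear_apZ.
Qed.

Lemma bounded_operator_gt0 : bounded_operator T ->
  exists2 M, 0 < M & forall x, `|T x| <= M * `|x|.
Proof.
(* When [K] is complex, [M] need not be real or nonnegative. But [M * |x|] dominates a norm, hence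
   equals its own norm [|M| * |x|]; adding 1 makes the constant positive. *)
move=> [_ [M TM]]; exists (`|M| + 1) => [|x]; first by rewrite ltr_wpDl.
have : 0 <= M * `|x| by apply: le_trans (TM x).
move=> /ger0_norm; rewrite normrM normr_id => Mx.
by apply: le_trans (TM x) _; rewrite -Mx mulrDl lerDl mul1r.
Qed.

End LinearMap.

Lemma bounded_operator_comp X Y Z (S : Y -> Z) (T : X -> Y) :
  bounded_operator S -> bounded_operator T -> bounded_operator (S \o T).
Proof.
move=> bS bT; split=> [a x y|]; first by rewrite /= bT.1 bS.1.
have [M M0 SM] := bounded_operator_gt0 bS.
have [N N0 TN] := bounded_operator_gt0 bT.
exists (M * N) => x /=; apply: le_trans (SM _) _.
by rewrite -mulrA ler_wpM2l// ltW.
Qed.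

Lemma isomorphism_comp X Y Z (S : Y -> Z) (T : X -> Y) :
  isomorphism S -> isomorphism T -> isomorphism (S \o T).
Proof.
move=> [bS [S' [bS' SK S'K]]] [bT [T' [bT' TK T'K]]].
split; first exact: bounded_operator_comp.
exists (T' \o S'); split; first exact: bounded_operator_comp.
- exact: can_comp.
- exact: can_comp.
Qed.

Lemma isomorphism_scale X c : c != 0 -> isomorphism (fun x : X => c *: x).
Proof.
have bc (a : K) : bounded_operator (fun x : X => a *: x).
  split=> [b x y|]; first by rewrite scalerDr !scalerA mulrC.
  by exists `|a| => x; rewrite normrZ.
move=> c0; split=> //; exists (fun x => c^-1 *: x); split=> // x.
  by rewrite scalerA mulVf ?scale1r.
by rewrite scalerA divff ?scale1r.
Qed.

(** The inverse of a linear bijection is linear, so a candidate inverse only needs a bound. *)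
Lemma isomorphism_can2 X Y (T : X -> Y) (S : Y -> X) : bounded_operator T ->
  cancel T S -> cancel S T -> (exists M, forall y, `|S y| <= M * `|y|) ->
  isomorphism T.
Proof.
move=> bT TK SK bS; split=> //; exists S; split=> //; split=> // a x y.
by apply: (can_inj TK); rewrite bT.1 !SK.
Qed.

Lemma bounded_operator_eq_norm X Y (T : X -> Y) (S : set X) :
  bounded_operator T -> dense S -> (forall x, S x -> `|T x| = `|x|) ->
  forall x, `|T x| = `|x|.
Proof.
move=> bT /denseP dS TS x; have [M M0 TM] := bounded_operator_gt0 bT.
apply/eqP; rewrite -subr_eq0 -normr_le0; apply/ler_addgt0Pl => e e0.
rewrite addr0.
(* Replacing [x] by [y] changes [|T x| - |x|] by at most [(M + 1) * |x - y|]. *)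
have [|y Sy xy] := dS x (e / (M + 1)); first by rewrite divr_gt0// addr_gt0.
have -> : `|T x| - `|x| = (`|T x| - `|T y|) + (`|y| - `|x|).
  by rewrite (TS y Sy) addrA subrK.
apply: le_trans (ler_normD _ _) _.
apply: (@le_trans _ _ (`|T (x - y)| + `|x - y|)).
  rewrite (linear_apB bT.1) lerD ?ler_dist_dist// [leRHS]distrC.
  exact: ler_dist_dist.
apply: (@le_trans _ _ ((M + 1) * `|x - y|)); first by rewrite mulrDl mul1r lerD.
by rewrite -ler_pdivlMl ?addr_gt0// mulrC ltW.
Qed.

End NormedSpaces.

(** The sets [S d] generate a proper filter, which is Cauchy because their diameters shrink; [l] is
    its limit. As the sets need not be closed, [l] is only approximated from within each of them.
    This serves to turn near-solutions of [T x = y] into a solution and near-minimizers into a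
    minimizer. *)
Lemma complete_shrinking {K : numFieldType} {X : completeNormedModType K}
    (S : K -> set X) :
  (forall d e, 0 < d -> d <= e -> S d `<=` S e) ->
  (forall d, 0 < d -> S d !=set0) ->
  (forall e, 0 < e -> exists2 d, 0 < d &
     forall x y, S d x -> S d y -> `|x - y| < e) ->
  exists l, forall e d, 0 < e -> 0 < d -> exists2 x, S d x & `|l - x| < e.
Proof.
move=> monoS S0 diamS.
pose F := filter_from [set d : K | 0 < d] S.
have FF : ProperFilter F.
  apply: filter_from_proper => //; apply: filter_from_filter.
    by exists 1 => /=.
  move=> d e /= d0 e0; exists (Order.min d e).
    by rewrite minElt; case: ifP.
  (* The order of [K] may be partial, but positive elements are real and hence comparable. *)
  have de : d >=< e by apply: real_comparable; rewrite gtr0_real.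
  have m0 : 0 < Order.min d e by rewrite minElt; case: ifP.
  by move=> x Sx; split; apply: monoS Sx => //; rewrite comparable_ge_min ?lexx ?orbT.
have : cauchy F.
  apply: cauchy_exP => e e0; have [d d0 Sd] := diamS e e0.
  have [x Sx] := S0 d d0; exists x; exists d => // y Sy.
  by rewrite -ball_normE; exact: Sd.
move/cauchy_cvg => Fl; exists (lim F) => e d e0 d0.
have [d' /= d'0] := Fl _ (nbhsx_ballx (lim F) e e0); rewrite -ball_normE => Sd'.
have m0 : 0 < Order.min d d' by rewrite minElt; case: ifP.
have dd' : d >=< d' by apply: real_comparable; rewrite gtr0_real.
have [x Sx] := S0 _ m0; exists x.
  by apply: monoS Sx => //; rewrite comparable_ge_min ?lexx.
by apply: Sd'; apply: monoS Sx => //; rewrite comparable_ge_min ?lexx ?orbT.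
Qed.

(** Density of the range provides points with [|y - T x| < d] for every [d]. Since [T] preserves
    distances, these sets have diameter at most [2 * d], so by completeness of [X] they shrink to an
    exact preimage of [y]. *)
Lemma isometry_isomorphism {K : numFieldType} {X : completeNormedModType K}
    {Y : normedModType K} (T : X -> Y) :
  bounded_operator T -> (forall x, `|T x| = `|x|) -> dense (range T) ->
  isomorphism T.
Proof.
move=> bT isoT /denseP dT.
have Tsurj y : exists x, T x = y.
  pose S d := [set x | `|y - T x| < d].
  have [d e _ de x|d d0|e e0|l Hl] := @complete_shrinking K X S.
  - by rewrite /S /= => /lt_le_trans; apply.
  - by have [_ [x _ <-]] := dT y d d0; exists x.
  - exists (e / 2) => [|x x' Sx Sx']; first by rewrite divr_gt0.
    rewrite -isoT (linear_apB bT.1) (splitr e).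
    have -> : T x - T x' = (T x - y) + (y - T x') by rewrite addrA subrK.
    by apply: le_lt_trans (ler_normD _ _) _; rewrite ltrD// distrC.
  - exists l; apply/eqP; rewrite -subr_eq0 -normr_le0.
    apply/ler_addgt0Pl => e e0; rewrite addr0.
    have h0 : 0 < e / 2 by rewrite divr_gt0.
    have [x Sx lx] := Hl (e / 2) (e / 2) h0 h0.
    have -> : T l - y = T (l - x) + (T x - y).
      by rewrite (linear_apB bT.1) addrA subrK.
    apply: le_trans (ler_normD _ _) _; rewrite isoT (splitr e).
    by rewrite lerD// ltW// distrC.
have Tinj : injective T.
  move=> x y Txy; apply/eqP.
  by rewrite -subr_eq0 -normr_eq0 -isoT (linear_apB bT.1) Txy subrr normr0.
pose S y := sval (cid (Tsurj y)).
have SK : cancel S T by move=> y; rewrite /S; case: cid.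
apply: (@isomorphism_can2 K X Y T S bT) => // [x|]; first by apply: Tinj; rewrite SK.
by exists 1 => y; rewrite mul1r -[in leRHS](SK y) isoT.
Qed.

(** For [x] in the span of [e], the squares of [|V x|] and [|x|] expand to the same double sum, as
    [e] and [e'] have the same Gram matrix. So [V] is isometric by density, and its range contains
    the dense span of [e']. *)
Lemma orthonormal_bases_isomorphism {K : numFieldType} {theta : K -> K}
    {X : hilbertType theta} {D : set nat} {e e' : nat -> X} {V : X -> X} :
  orthonormal_basis D e -> orthonormal_basis D e' -> bounded_operator V ->
  (forall n, D n -> V (e n) = e' n) -> isomorphism V.
Proof.
move=> [oe de] [oe' de'] bV Ve.
have isoV : forall x, `|V x| = `|x|.
  apply: (bounded_operator_eq_norm bV de) => _ [n [c [v [ev ->]]]].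
  apply/eqP; rewrite -(@eqrXn2 _ 2)//.
  rewrite -!innerxx (linear_ap_sum bV.1) !linear_sumlz; apply/eqP.
  apply: eq_bigr => i _; rewrite !linear_sumr; apply: eq_bigr => j _.
  rewrite !linearZl_LR !linearZr_LR.
  have [p Dp <-] := ev i; have [q Dq <-] := ev j.
  by rewrite !Ve//= oe// oe'.
apply: isometry_isomorphism => //; apply/denseP => y eps eps0.
have [_ [n [c [v [ev ->]]]] yx] := (denseP _).1 de' y eps eps0.
exists (\sum_(i < n) c i *: v i) => //.
have /boolp.choice[w Vw] : forall i, exists x, V x = v i.
  by move=> i; have [p Dp <-] := ev i; exists (e p); exact: Ve.
exists (\sum_(i < n) c i *: w i) => //.
by rewrite (linear_ap_sum bV.1); apply: eq_bigr => i _; rewrite Vw.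
Qed.

(** * Real Hilbert spaces: Cauchy-Schwarz inequality and Riesz representation *)

Lemma discriminant_le (R : realFieldType) (a b d : R) : 0 <= a ->
  (forall t, - d <= t ^+ 2 * a + 2 * t * b) -> b ^+ 2 <= d * a.
Proof.
rewrite le_eqVlt => /orP[/eqP <- H|a0 H]; last first.
  (* The quadratic in [t] is minimal at [t = - b / a]. *)
  have := H (- b / a); rewrite -(ler_pM2r a0).
  have -> : ((- b / a) ^+ 2 * a + 2 * (- b / a) * b) * a = - b ^+ 2.
    by field; rewrite gt_eqF.
  by rewrite mulNr lerN2.
have [->|b0] := eqVneq b 0; first by rewrite expr0n mulr0.
(* Now [a = 0] and the bound is linear in [t]; this [t] would give [- d <= - (d + 1)]. *)
have := H (- (d + 1) / (2 * b)).
have -> : 2 * (- (d + 1) / (2 * b)) * b = - (d + 1) by field.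
lra.
Qed.

Section RealHilbert.
Context {R : realType} {H : realHilbertType R}.
Implicit Types x y z : H.

Lemma innerC x y : inner x y = inner y x.
Proof. by rewrite hermC expr0 mul1r. Qed.

Lemma inner_addZ x y t :
  `|x + t *: y| ^+ 2 = `|x| ^+ 2 + 2 * t * inner x y + t ^+ 2 * `|y| ^+ 2.
Proof.
rewrite -!innerxx [LHS]linearDl/= ![inner _ (_ + _)]linearDr/=.
rewrite ![inner (_ *: _) _]linearZl_LR ![inner _ (_ *: _)]linearZr_LR/=.
by rewrite [inner y (_ *: _)]linearZr_LR /= (innerC y x); ring.
Qed.

(** The square of [|x + t *: y|] is a nonnegative quadratic in [t], which bounds its
    discriminant. *)
Lemma inner_CauchySchwarz x y : `|inner x y| <= `|x| * `|y|.
Proof.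
rewrite -(@ler_pXn2r _ 2) ?nnegrE ?mulr_ge0// real_normK ?num_real// exprMn.
apply: discriminant_le => [|t]; first exact: sqr_ge0.
by rewrite lerNl -subr_ge0; have := sqr_ge0 `|x + t *: y|; rewrite inner_addZ; lra.
Qed.

Lemma inner_injr y z : (forall x, inner x y = inner x z) -> y = z.
Proof.
move=> yz; apply/eqP; rewrite -subr_eq0 -normr_eq0 -sqrf_eq0 -innerxx.
by rewrite linearBr/= yz subrr.
Qed.

(* The representing vector minimizes |x|^2 - 2 phi x. *)
Lemma riesz_representation (phi : H -> R) :
  (forall a x y, phi (a *: x + y) = a * phi x + phi y) ->
  (exists M, forall x, `|phi x| <= M * `|x|) ->
  exists z, forall x, phi x = inner x z.
Proof.
move=> lphi [M phiM].
pose J x := `|x| ^+ 2 - 2 * phi x.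
have JD x y t : J (x + t *: y) =
    J x + 2 * t * (inner x y - phi y) + t ^+ 2 * `|y| ^+ 2.
  by rewrite /J inner_addZ [x + _]addrC lphi; ring.
have phi0 : phi 0 = 0 by have := lphi 1 0 0; rewrite scaler0 addr0; lra.
have J0 : has_inf (range J).
  split; first by exists (J 0), 0.
  (* [J x] is at least [|x| ^+ 2 - 2 * M * |x|]; complete the square. *)
  exists (- M ^+ 2) => _ [x _ <-]; rewrite /J.
  have := sqr_ge0 (`|x| - M).
  have := ler_norm (phi x); have := phiM x; nra.
pose m := inf (range J).
have Jm x : m <= J x by apply: ge_inf; [exact: J0.2|exists x].
pose S d := [set x | J x < m + d].
have [d e d0 de x|d d0|e e0|l Hl] := @complete_shrinking R H S.
- by rewrite /S /= => /lt_le_trans; apply; rewrite lerD2l.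
- by have [_ [x _ <-] Jx] := inf_adherent d0 J0; exists x.
- exists (e ^+ 2 / 4) => [|x y]; first by rewrite divr_gt0 ?exprn_gt0.
  rewrite /S /= => Jx Jy; have := Jm (x + 2^-1 *: (y - x)).
  rewrite JD => Jxy; have : J y = J (x + 1 *: (y - x)).
    by rewrite scale1r addrC subrK.
  rewrite JD expr1n mul1r => Jye.
  rewrite -(@ltr_pXn2r _ 2) ?nnegrE ?(ltW e0)// (distrC x).
  move: Jx Jy Jxy Jye; set u := `|_| ^+ 2; set v := inner _ _ - _; set w := _ ^+ 2.
  have -> : (2^-1 : R) ^+ 2 = 4^-1 by rewrite exprVn; congr (_ ^-1); ring.
  lra.
exists l => h; rewrite innerC; apply/eqP; rewrite eq_sym -subr_eq0 -normr_le0.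
apply/ler_addgt0Pl => e e0; rewrite addr0.
(* Both error terms below are at most [c * |h|], so their sum stays below [e]; the added 1 covers
   [h = 0]. *)
pose c := e / (2 * (`|h| + 1)).
have h1 : 0 < `|h| + 1 by rewrite ltr_wpDl.
have c0 : 0 < c by rewrite divr_gt0// mulr_gt0.
have c20 : 0 < c ^+ 2 by rewrite exprn_gt0.
have [x Sx lx] := Hl c (c ^+ 2) c0 c20.
(* Since [J x < m + c ^+ 2], moving from [x] along [h] cannot lower [J] by more than [c ^+ 2]; the
   discriminant bound then controls the linear coefficient. *)
have xh : `|inner x h - phi h| <= c * `|h|.
  rewrite -(@ler_pXn2r _ 2) ?nnegrE // ?(mulr_ge0 (ltW c0))//.
  rewrite real_normK ?num_real// exprMn.
  apply: discriminant_le => [|t]; first exact: sqr_ge0.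
  by have := Jm (x + t *: h); rewrite JD; move: Sx; rewrite /S /=; lra.
have lxh : `|inner (l - x) h| <= c * `|h|.
  by apply: le_trans (inner_CauchySchwarz _ _) _; rewrite ler_wpM2r// ltW.
have -> : inner l h - phi h = inner (l - x) h + (inner x h - phi h).
  by rewrite linearBl/= addrA subrK.
apply: le_trans (ler_normD _ _) _.
have -> : e = 2 * (c * (`|h| + 1)) by rewrite /c; field; rewrite gt_eqF.
by move: xh lxh; lra.
Qed.

End RealHilbert.

(** * Adjoints of bounded operators on a real Hilbert space *)

Section Adjoint.
Context {R : realType} {H : realHilbertType R}.
Implicit Types A B : H -> H.

Lemma inner_adjoint A x y : bounded_operator A ->
  inner (A x) y = inner x (adjoint A y).
Proof.
move=> bA; have [M M0 AM] := bounded_operator_gt0 bA.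
suff : exists z, forall x, inner (A x) y = inner x z.
  by move=> /(xgetPex 0)/(_ x).
apply: riesz_representation => [a u v|].
  by rewrite bA.1 linearDl/= linearZl_LR.
exists (M * `|y|) => u; apply: le_trans (inner_CauchySchwarz _ _) _.
by rewrite mulrAC ler_wpM2r.
Qed.

Lemma adjoint_eq A B : bounded_operator A ->
  (forall x y, inner (A x) y = inner x (B y)) -> adjoint A = B.
Proof.
move=> bA AB; apply/funext => y; apply: inner_injr => x.
by rewrite -inner_adjoint.
Qed.

Lemma bounded_operator_adjoint A : bounded_operator A ->
  bounded_operator (adjoint A).
Proof.
move=> bA; split=> [a y z|].
  apply: inner_injr => x; rewrite linearDr/= linearZr_LR/= -!inner_adjoint//.
  by rewrite linearDr/= linearZr_LR.
have [M M0 AM] := bounded_operator_gt0 bA; exists M => y.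
have [->|Ay0] := eqVneq (adjoint A y) 0; first by rewrite normr0 mulr_ge0// ltW.
(* The square of [|adjoint A y|] is [inner (A (adjoint A y)) y], at most
   [M * |adjoint A y| * |y|]. *)
rewrite -(@ler_pM2l _ `|adjoint A y|) ?normr_gt0// -expr2 -innerxx.
rewrite -inner_adjoint//; apply: le_trans (ler_norm _) _.
apply: le_trans (inner_CauchySchwarz _ _) _.
by rewrite mulrA ler_wpM2r// mulrC.
Qed.

Lemma adjointK A : bounded_operator A -> adjoint (adjoint A) = A.
Proof.
move=> bA; apply: adjoint_eq; first exact: bounded_operator_adjoint.
by move=> x y; rewrite innerC -inner_adjoint// innerC.
Qed.

Lemma isomorphism_adjoint A : isomorphism A -> isomorphism (adjoint A).
Proof.
move=> [bA [S [bS AK SK]]]; split; first exact: bounded_operator_adjoint.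
exists (adjoint S); split; first exact: bounded_operator_adjoint.
  by move=> y; apply: inner_injr => x; rewrite -!inner_adjoint// SK.
by move=> y; apply: inner_injr => x; rewrite -!inner_adjoint// AK.
Qed.

Lemma isomorphism_adjoint_sqrD1 A : bounded_operator A ->
  isomorphism (fun x => x + A (A x)) ->
  isomorphism (fun x => x + adjoint A (adjoint A x)).
Proof.
move=> bA iA; rewrite (_ : (fun x => _) = adjoint (fun x => x + A (A x))).
  exact: isomorphism_adjoint.
apply/esym/adjoint_eq => [|x y]; first exact: iA.1.
by rewrite linearDl/= linearDr/= !inner_adjoint.
Qed.

End Adjoint.

(** * Norms, operators and orthonormal bases on the complexification *)

Section Complexification.
Context {R : realType} {H : realHilbertType R}.
Local Notation HC := (complexification H).
Implicit Types (A U : H -> H) (z w : HC).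

Lemma cplx_normE z : `|z| = (Num.sqrt (`|z.1| ^+ 2 + `|z.2| ^+ 2))%:C%C.
Proof. by []. Qed.

Lemma cplx_norm_le z : `|z| <= (`|z.1| + `|z.2|)%:C%C.
Proof.
rewrite cplx_normE lecR -[leRHS]ger0_norm ?addr_ge0// -sqrtr_sqr.
by rewrite ler_wsqrtr// sqrrD addrAC lerDl mulrn_wge0// mulr_ge0.
Qed.

Lemma cplx_norm_ge z : (`|z.1| + `|z.2|)%:C%C <= 2 * `|z|.
Proof.
rewrite cplx_normE -(rmorph_nat (real_complex R)) -rmorphM lecR.
rewrite mulr_natl mulr2n lerD// -[leLHS]normr_id -sqrtr_sqr ler_wsqrtr//.
  by rewrite lerDl sqr_ge0.
by rewrite lerDr sqr_ge0.
Qed.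

(** The sum of the norms of the two components is equivalent to the norm of [z], so estimates can be
    carried out in [R]. *)
Lemma cplx_bounded (S : HC -> HC) (M : R) :
  (forall z, `|(S z).1| + `|(S z).2| <= M * (`|z.1| + `|z.2|)) ->
  exists M : R[i], forall z, `|S z| <= M * `|z|.
Proof.
move=> SM; exists (`|M|%:C%C * 2) => z; apply: le_trans (cplx_norm_le _) _.
apply: (@le_trans _ _ (`|M| * (`|z.1| + `|z.2|))%:C%C).
  by rewrite lecR; apply: le_trans (SM z) _; rewrite ler_wpM2r ?addr_ge0// ler_norm.
by rewrite rmorphM -mulrA ler_wpM2l ?lecR// cplx_norm_ge.
Qed.

Lemma complex_extension_bounded_operator A : bounded_operator A ->
  bounded_operator (complex_extension A).
Proof.
move=> bA; split=> [[a b] [x y] [x' y']|].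
  congr (_, _) => /=.
    by rewrite (linear_apD bA.1) (linear_apB bA.1) !(linear_apZ bA.1).
  by rewrite !(linear_apD bA.1) !(linear_apZ bA.1).
have [M M0 AM] := bounded_operator_gt0 bA.
by apply: (@cplx_bounded _ M) => z /=; rewrite mulrDr lerD.
Qed.

Lemma complex_extension_isomorphism A : isomorphism A ->
  isomorphism (complex_extension A).
Proof.
move=> [bA [S [bS AK SK]]]; split; first exact: complex_extension_bounded_operator.
exists (complex_extension S); split; first exact: complex_extension_bounded_operator.
  by case=> x y; rewrite /complex_extension /cplx/= !AK.
by case=> x y; rewrite /complex_extension /cplx/= !SK.
Qed.

Lemma cplx_orthonormal_basis D (e : nat -> H) : orthonormal_basis D e ->
  orthonormal_basis D (fun n => cplx (e n) 0 : HC).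
Proof.
move=> [oe /denseP de]; split=> [m n Dm Dn|].
  have -> : inner (cplx (e m) 0 : HC) (cplx (e n) 0) =
      Complex (inner (e m) (e n) + inner (0 : H) 0)
              (inner 0 (e n) - inner (e m) 0) by [].
  rewrite oe// !linear0l !linear0r subrr addr0.
  by rewrite -(rmorph_nat (real_complex R)).
apply/denseP => z [eps eps']; rewrite ltcE/= => /andP[/eqP -> eps0].
have h0 : 0 < eps / 2 by rewrite divr_gt0.
have [_ [n1 [c1 [v1 [ev1 ->]]]] zx] := de z.1 _ h0.
have [_ [n2 [c2 [v2 [ev2 ->]]]] zy] := de z.2 _ h0.
exists (cplx (\sum_(i < n1) c1 i *: v1 i) (\sum_(i < n2) c2 i *: v2 i)); last first.
  apply: le_lt_trans (cplx_norm_le _) _.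
  by rewrite ltcR [ltRHS](splitr eps) ltrD.
(* The imaginary part is reached by purely imaginary coefficients: i times [c2 j], applied to
   [v2 j + i0], gives [0 + i (c2 j *: v2 j)]. *)
exists (n1 + n2)%N, (fun i : 'I_(n1 + n2) => match fintype.split i with
    | inl j => (c1 j)%:C%C | inr j => Complex 0 (c2 j) end),
  (fun i : 'I_(n1 + n2) => match fintype.split i with
    | inl j => cplx (v1 j) 0 | inr j => cplx (v2 j) 0 end).
split=> [i|].
  case: (fintype.split i) => j; [have [p Dp <-] := ev1 j|have [p Dp <-] := ev2 j];
    by exists p.
have splitl (i : 'I_n1) : fintype.split (lshift n2 i) = inl i by exact: (unsplitK (inl i)).
have splitr (i : 'I_n2) : fintype.split (rshift n1 i) = inr i by exact: (unsplitK (inr i)).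
rewrite big_split_ord/=.
have -> : cplx (\sum_(i < n1) c1 i *: v1 i) (\sum_(i < n2) c2 i *: v2 i) =
    cplx (\sum_(i < n1) c1 i *: v1 i) 0 + cplx 0 (\sum_(i < n2) c2 i *: v2 i) :> HC.
  by congr (_, _) => /=; rewrite ?addr0 ?add0r.
congr (_ + _).
  under eq_bigr do rewrite splitl.
  elim/big_ind2 : _ => // [x1 x2 y1 y2 <- <-|i _].
    by congr (_, _) => /=; rewrite addr0.
  by congr (_, _) => /=; rewrite !scale0r ?scaler0 ?subr0 ?addr0.
under eq_bigr do rewrite splitr.
elim/big_ind2 : _ => // [x1 x2 y1 y2 <- <-|i _].
  by congr (_, _) => /=; rewrite addr0.
by congr (_, _) => /=; rewrite !scale0r ?scaler0 ?subr0 ?add0r.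
Qed.

(** * The resolvent at i and -i together, as [ep] times i with [ep] equal to 1 or -1 *)

Section Resolvent.
Variables (A : H -> H) (ep : R).
Hypotheses (bA : bounded_operator A) (ep2 : ep * ep = 1).

Let AD := linear_apD bA.1.
Let AB := linear_apB bA.1.
Let AZ := linear_apZ bA.1.

Let resE z : Complex 0 ep *: z - complex_extension A z =
  cplx (- (ep *: z.2) - A z.1) (ep *: z.1 - A z.2).
Proof. by congr (_, _) => /=; rewrite scale0r ?add0r. Qed.

Let epZK x : ep *: (ep *: x) = x :> H.
Proof. by rewrite scalerA ep2 scale1r. Qed.

Let ep1 : `|ep| = 1.
Proof. by apply/eqP; rewrite -sqrp_eq1// -normrX expr2 ep2 normr1. Qed.

Let T z := Complex 0 ep *: z - complex_extension A z.

Let bT : bounded_operator T.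
Proof.
have bC := complex_extension_bounded_operator bA.
split=> [a z w|].
  by rewrite /T bC.1 scalerDr scalerBr !scalerA (mulrC a) opprD addrACA.
have [M M0 AM] := bounded_operator_gt0 bC.
exists (`|Complex 0 ep| + M) => z; apply: le_trans (ler_normB _ _) _.
by rewrite normrZ mulrDl lerD.
Qed.

Let bB : bounded_operator (fun x => x + A (A x)).
Proof.
split=> [a x y|].
  by rewrite !bA.1 scalerDr addrACA.
have [M M0 AM] := bounded_operator_gt0 bA.
exists (1 + M * M) => x; apply: le_trans (ler_normD _ _) _.
rewrite mulrDl mul1r lerD2l; apply: le_trans (AM _) _.
by rewrite -mulrA ler_wpM2l// ltW.
Qed.

Lemma isomorphism_resolvent :
  isomorphism (fun z => Complex 0 ep *: z - complex_extension A z) <->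
  isomorphism (fun x => x + A (A x)).
Proof.
have [M M0 AM] := bounded_operator_gt0 bA.
split=> [[_ [S [bS TK SK]]]|[_ [S [bS BK SK]]]].
  (* For the right-hand side [- (ep *: y)], the solution [a + ib] satisfies [a = ep *: A b] by the
     imaginary part of the equation; the real part then becomes [b + A (A b) = y]. *)
  apply: (@isomorphism_can2 _ _ _ _ (fun y => (S (cplx (- (ep *: y)) 0)).2) bB).
  - move=> b; have := TK (cplx (ep *: A b) b).
    rewrite resE /= epZK subrr AZ -opprD -scalerDr.
    by move=> /(congr1 snd).
  - move=> y; have := SK (cplx (- (ep *: y)) 0); rewrite resE.
    case: (S _) => a b /= [e1 e2].
    have -> : A b = ep *: a by apply/esym/eqP; rewrite -subr_eq0 e2.
    rewrite AZ; apply: (can_inj epZK); rewrite scalerDr epZK.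
    by apply: oppr_inj; rewrite opprD.
  - have [[N N'] + SN] := bounded_operator_gt0 bS.
    rewrite ltcE/= => /andP[/eqP N'0 N0]; rewrite {N'}N'0 in SN.
    exists (2 * N) => y; set z := cplx _ _.
    have zy : `|z| <= `|y|%:C%C.
      apply: le_trans (cplx_norm_le _) _.
      by rewrite normr0 addr0 normrN normrZ ep1 mul1r.
    have : (`|(S z).1| + `|(S z).2|)%:C%C <= (2 * (N * `|y|))%:C%C.
      apply: le_trans (cplx_norm_ge _) _.
      rewrite rmorphM rmorph_nat ler_wpM2l//; apply: le_trans (SN _) _.
      by rewrite rmorphM ler_wpM2l// lecR ltW.
    by rewrite lecR mulrA => SzM; apply: le_trans SzM; rewrite lerDr.
(* Solve for [a + ib] by elimination: the imaginary part gives [a = ep *: (z.2 + A b)], and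
   substituting into the real part gives [b + A (A b) = - (ep *: z.1) - A z.2]. *)
apply: (@isomorphism_can2 _ _ _ _ (fun z =>
  let b := S (- (ep *: z.1) - A z.2) in cplx (ep *: (z.2 + A b)) b) bT).
- case=> a b; rewrite /T resE /=.
  have -> : - (ep *: (- (ep *: b) - A a)) - A (ep *: a - A b) = b + A (A b).
    rewrite AB AZ scalerBr scalerN epZK !opprB opprK.
    by rewrite addrC addrA subrK addrC.
  by rewrite BK subrK epZK.
- case=> x y /=; set b := S _; rewrite /T resE /= epZK addrK; congr (_, _).
  rewrite AZ AD -opprD -scalerDr addrCA SK addrC subrK.
  by rewrite scalerN epZK opprK.
have [N N0 SN] := bounded_operator_gt0 bS.
(* The sum of the component norms is at most [|z.2| + (1 + M) * |b|], and [|b|] is estimated in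
   [bN]. *)
apply: (@cplx_bounded _ (1 + (1 + M) * (N * (1 + M)))) => z /=.
set b := S _.
have bN : `|b| <= N * (1 + M) * (`|z.1| + `|z.2|).
  apply: le_trans (SN _) _; rewrite -mulrA ler_wpM2l ?(ltW N0)//.
  apply: le_trans (ler_normB _ _) _; rewrite normrN normrZ ep1 mul1r.
  rewrite mulrDl mul1r mulrDr addrACA lerD//.
    by rewrite lerDl mulr_ge0// ltW.
  by apply: le_trans (AM _) _; rewrite lerDr.
rewrite normrZ ep1 mul1r; apply: (@le_trans _ _ (`|z.2| + (1 + M) * `|b|)).
  by rewrite mulrDl mul1r (addrC `|b|) addrA lerD2r (le_trans (ler_normD _ _))// lerD2l.
rewrite [leRHS]mulrDl mul1r lerD ?lerDr//.
by rewrite -mulrA ler_wpM2l// addr_ge0// ltW.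
Qed.

End Resolvent.
End Complexification.

(** * Gram-Schmidt orthonormalization in a separable real Hilbert space *)

Lemma countable_dense_seq (K : numFieldType) (X : normedModType K) :
  separable_space X -> exists d : nat -> X, dense (range d).
Proof.
move=> [S /countable_injP[f injf] /denseP dS].
(* Indices outside the image of [f] give the default 0, which is harmless: the range only has to
   contain [S]. *)
exists (fun k => xget 0 [set x | S x /\ f x = k]); apply/denseP => x eps eps0.
have [y Sy xy] := dS x eps eps0; exists y => //; exists (f y) => //.
have [yS fy] := xgetPex 0 (ex_intro [set x | S x /\ f x = f y] y (conj Sy erefl)).
by apply: injf; rewrite ?inE.
Qed.

Section GramSchmidt.
Context {R : realType} {H : realHilbertType R}.
Implicit Types (e d : nat -> H) (x y : H).

Definition orthonormal_upto e n :=
  forall i j, (i < n)%N -> (j < n)%N -> inner (e i) (e j) = (i == j)%:R.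

(** When the first [n] vectors are orthonormal, this is the component of [x] orthogonal to their
    span. *)
Definition residual e n x := x - \sum_(i < n) inner x (e i) *: e i.

Lemma residualS e n x : residual e n.+1 x = residual e n x - inner x (e n) *: e n.
Proof. by rewrite /residual big_ord_recr/= opprD addrA. Qed.

Lemma residualB e n x y : residual e n (x - y) = residual e n x - residual e n y.
Proof.
rewrite /residual (_ : \sum_(i < n) inner (x - y) (e i) *: e i =
  \sum_(i < n) inner x (e i) *: e i - \sum_(i < n) inner y (e i) *: e i).
  by rewrite !opprB addrACA [RHS]addrACA (addrC (- y)).
by rewrite -sumrB; apply: eq_bigr => i _; rewrite linearBl/= scalerBl.
Qed.

Lemma inner_residual e n x i : orthonormal_upto e n -> (i < n)%N ->
  inner (residual e n x) (e i) = 0.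
Proof.
move=> oe ni; rewrite linearBl/= linear_sumlz (bigD1 (Ordinal ni))//=.
rewrite linearZl_LR/= oe// eqxx mulr1 big1 ?addr0 ?subrr// => j ji.
by rewrite linearZl_LR/= oe// (_ : (j == i :> nat) = false) ?mulr0//; apply: negbTE.
Qed.

(** The residual [r] of [z] is orthogonal to the subtracted projection, so [inner r r = inner r z]
    and [|r| <= |z|]. Taking residuals is thus continuous, and vanishing on a dense set suffices. *)
Lemma residual_eq0 e n : orthonormal_upto e n ->
  forall S, dense S -> (forall x, S x -> residual e n x = 0) ->
  forall x, residual e n x = 0.
Proof.
move=> oe S /denseP dS S0 x; apply/eqP; rewrite -normr_le0.
apply/ler_addgt0Pl => eps eps0; rewrite addr0.
have [y Sy xy] := dS x eps eps0; apply: le_trans (ltW xy).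
have -> : residual e n x = residual e n (x - y).
  by rewrite residualB (S0 y Sy) subr0.
set z := x - y; set r := residual e n z.
have [->|r0] := eqVneq r 0; first by rewrite normr0.
rewrite -(@ler_pM2l _ `|r|) ?normr_gt0// -expr2 -innerxx.
have -> : inner r r = inner r z.
  rewrite {2}/r /residual linearBr/= linear_sumr/= big1 ?subr0// => i _.
  by rewrite linearZr_LR/= inner_residual// mulr0.
exact: le_trans (ler_norm _) (inner_CauchySchwarz _ _).
Qed.

(* With no nonzero residual left, the default makes the next vector zero. *)
Definition gs_next d (s : seq H) : H :=
  let r k := d k - \sum_(v <- s) inner (d k) v *: v in
  xget 0 [set v | exists2 k, r k != 0 /\ forall j, (j < k)%N -> r j = 0 &
                             v = `|r k|^-1 *: r k].

(** Course-of-values recursion: the iterated list holds [gs d 0], ..., [gs d (n - 1)] in order. *)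
Definition gs d n : H :=
  gs_next d (iter n (fun s => rcons s (gs_next d s)) [::]).

Lemma gsP d n : (exists k, residual (gs d) n (d k) != 0) ->
  exists k, [/\ residual (gs d) n (d k) != 0,
    forall j, (j < k)%N -> residual (gs d) n (d j) = 0 &
    gs d n = `|residual (gs d) n (d k)|^-1 *: residual (gs d) n (d k)].
Proof.
pose r k := d k -
  \sum_(v <- iter n (fun s => rcons s (gs_next d s)) [::]) inner (d k) v *: v.
have rE k : r k = residual (gs d) n (d k).
  congr (_ - _); elim: n {r} => [|n IHn]; first by rewrite big_nil big_ord0.
  by rewrite iterS -cats1 big_cat big_seq1 big_ord_recr IHn.
move=> [k0 rk0]; have exr : exists k, r k != 0 by exists k0; rewrite rE.
have /(xgetPex 0)[k [rk rmin] gsE] : exists v, [set v | exists2 k,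
    r k != 0 /\ (forall j, (j < k)%N -> r j = 0) & v = `|r k|^-1 *: r k] v.
  case: (ex_minnP exr) => k rk kmin.
  exists (`|r k|^-1 *: r k), k => //; split=> // j jk.
  by apply/eqP; apply: contraTT jk => /kmin; rewrite -leqNgt.
exists k; rewrite -rE; split=> // j; rewrite -rE; exact: rmin.
Qed.

(** Always normalizing the first nonzero residual ensures that [d j] lies in the span after at most
    [j + 1] steps, even though dependent vectors are skipped. *)
Lemma gs_orthonormal d n :
  (forall m, (m < n)%N -> exists k, residual (gs d) m (d k) != 0) ->
  orthonormal_upto (gs d) n /\
  forall j, (j < n)%N -> residual (gs d) n (d j) = 0.
Proof.
elim: n => [_|n IHn ex]; first by split.
have [|on resn] := IHn; first by move=> m mn; apply: ex; exact: ltnW.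
have [k [k0 kmin gsE]] := gsP (ex n (ltnSn n)).
set r := residual _ _ _ in k0 gsE.
have rE : `|r| *: gs d n = r by rewrite gsE scalerA divff ?normr_eq0// scale1r.
have n1 : inner (gs d n) (gs d n) = 1.
  by rewrite innerxx gsE normrZ normfV normr_id mulVf ?normr_eq0// expr1n.
have n0 i : (i < n)%N -> inner (gs d n) (gs d i) = 0.
  by move=> ni; rewrite gsE linearZl_LR/= inner_residual// mulr0.
split=> [i j|j].
  rewrite !ltnS leq_eqVlt => /orP[/eqP ->|ni]; rewrite leq_eqVlt => /orP[/eqP ->|nj].
  - by rewrite eqxx.
  - by rewrite n0// gtn_eqF.
  - by rewrite innerC n0// ltn_eqF.
  - exact: on.
have res_inner x : inner x (gs d n) = inner (residual (gs d) n x) (gs d n).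
  rewrite linearBl/= linear_sumlz big1 ?subr0// => i _.
  by rewrite linearZl_LR/= [inner (gs d i) _]innerC n0// mulr0.
rewrite residualS res_inner ltnS => jn.
have [->|rj] := eqVneq (residual (gs d) n (d j)) 0.
  by rewrite linear0l scale0r subr0.
(* Residuals before [n] vanish, so [j <= n <= k]; minimality of [k] gives [k <= j]. The new vector
   is the normalized residual of [d k], so it cancels that residual. *)
have -> : j = k.
  apply/eqP; rewrite eqn_leq; apply/andP; split.
    apply: leq_trans jn _; rewrite leqNgt; apply: contra k0 => kn.
    by rewrite /r resn.
  by rewrite leqNgt; apply: contra rj => jk; rewrite kmin.
by rewrite -/r -rE linearZl_LR/= n1 mulr1 subrr.
Qed.

(** Orthonormal vectors are linearly independent, so their coordinate rows form a matrix of rank [n]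
    with [m] columns. *)
Lemma has_dim_orthonormal_leq e n m : orthonormal_upto e n -> has_dim H m ->
  (n <= m)%N.
Proof.
move=> oe [[f lf bf]].
pose A := \matrix_(i < n) f (e i).
suff /eqP <- : row_free A by exact: rank_leq_col.
apply: inj_row_free => u uA.
have f0 : f 0 = 0 by have := lf (-1) 0 0; rewrite scaler0 addr0 scaleN1r addNr.
have fs : f (\sum_(i < n) u 0 i *: e i) = u *m A.
  rewrite mulmx_sum_row; under [RHS]eq_bigr do rewrite rowK.
  elim/big_rec2 : _ => // i y1 y2 _ <-.
  by rewrite lf.
have s0 : \sum_(i < n) u 0 i *: e i = 0.
  by apply: (bij_inj bf); rewrite fs uA f0.
apply/rowP => i; rewrite mxE; have := congr1 (inner^~ (e i)) s0.
rewrite /= linear0l linear_sumlz (bigD1 i)//= linearZl_LR/= oe// eqxx mulr1.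
rewrite big1 ?addr0// => j ji; rewrite linearZl_LR/= oe//.
by rewrite (_ : (j == i :> nat) = false) ?mulr0//; apply: negbTE.
Qed.

Lemma orthonormal_has_dim e n : orthonormal_upto e n ->
  (forall x, residual e n x = 0) -> has_dim H n.
Proof.
move=> oe r0; constructor; exists (fun x => \row_(i < n) inner x (e i)).
  by move=> a x y; apply/rowP => i; rewrite !mxE linearDl/= linearZl_LR.
exists (fun v : 'rV_n => \sum_(i < n) v 0 i *: e i).
  move=> x; apply/esym/eqP; rewrite -subr_eq0; apply/eqP; rewrite -[RHS](r0 x).
  by congr (_ - _); apply: eq_bigr => i _; rewrite mxE.
move=> v; apply/rowP => i; rewrite mxE linear_sumlz (bigD1 i)//= linearZl_LR/=.
rewrite oe// eqxx mulr1 big1 ?addr0// => j ji; rewrite linearZl_LR/= oe//.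
by rewrite (_ : (j == i :> nat) = false) ?mulr0//; apply: negbTE.
Qed.

Lemma residual_span (D : set nat) e n x : (forall i, (i < n)%N -> D i) ->
  residual e n x = 0 -> linear_span (e @` D) x.
Proof.
move=> De /eqP; rewrite subr_eq0 => /eqP ->.
exists n, (fun i => inner x (e i)), (fun i => e i); split=> // i.
by exists i => //; exact: De.
Qed.

(** Either Gram-Schmidt never stops, and then no finite dimension is possible and the index set is
    all of nat; or it first stops at some [n], and then all residuals vanish by density and [H] has
    dimension [n]. *)
Lemma separable_orthonormal_basis : separable_space H ->
  exists e, orthonormal_basis (index_set H) e.
Proof.
move=> /countable_dense_seq[d dd]; exists (gs d).
suff [on span] : (forall i j, index_set H i -> index_set H j ->
      inner (gs d i) (gs d j) = (i == j)%:R) /\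
    (forall k, linear_span (gs d @` index_set H) (d k)).
  split=> //; apply/denseP => x eps eps0.
  have [_ [k _ <-] xk] := (denseP _).1 dd x eps eps0.
  by exists (d k).
have [ex|] := pselect (forall n, exists k, residual (gs d) n (d k) != 0).
  have H_ n := gs_orthonormal (fun m (_ : (m < n)%N) => ex m).
  have DT i : index_set H i.
    move=> m /(has_dim_orthonormal_leq (H_ m.+1).1).
    by rewrite ltnn.
  split=> [i j _ _|k].
    by apply: (H_ (i + j).+1).1; rewrite ltnS ?leq_addr ?leq_addl.
  by apply: residual_span ((H_ k.+1).2 k (ltnSn k)).
move=> /existsNP nex.
(* The boolean form allows the least such [n] to be taken, so that the process runs at every earlier
   stage. *)
have {nex} : exists n, `[< ~ exists k, residual (gs d) n (d k) != 0 >].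
  by case: nex => n nn; exists n; apply/asboolP.
move=> /ex_minnP[n /asboolP nn nmin].
have [m mn|on _] := @gs_orthonormal d n.
  apply: contrapT => nm; have := nmin m; rewrite leqNgt mn => /(_ _)/negP.
  by apply=> //; apply/asboolP.
have r0 k : residual (gs d) n (d k) = 0.
  by apply/eqP/negPn/negP => rk; apply: nn; exists k.
have dimn : has_dim H n.
  apply: (orthonormal_has_dim on); apply: (residual_eq0 on dd).
  by move=> _ [k _ <-].
have DE i : index_set H i <-> (i < n)%N.
  split=> [|ni m dimm]; first exact.
  exact: leq_trans ni (has_dim_orthonormal_leq on dimm).
split=> [i j /DE ni /DE nj|k]; first exact: on.
by apply: residual_span (r0 k) => i /DE.
Qed.

End GramSchmidt.

(** * The family [f n + i A (f n)] and the equivalence *)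

Lemma oppr_imaginary (R : rcfType) : - 'i%C = Complex 0 (-1) :> R[i].
Proof. by apply/eqP; rewrite eq_complex /= oppr0 !eqxx. Qed.

Section Graph.
Context {R : realType} {H : realHilbertType R}.
Local Notation HC := (complexification H).

Let imaginary_neq0 (ep : R) : ep != 0 -> Complex 0 ep != 0.
Proof. by rewrite eq_complex /= eqxx. Qed.

Lemma isomorphism_1Di (A : H -> H) :
  isomorphism (fun z : HC => Complex 0 1 *: z - complex_extension A z) <->
  isomorphism (fun z : HC => z + Complex 0 1 *: complex_extension A z).
Proof.
have i2 : Complex 0 1 * Complex 0 1 = -1 :> R[i].
  by apply/eqP; rewrite eq_complex /=; apply/andP; split; apply/eqP; ring.
split=> iA.
  rewrite (_ : (fun z => _) = ( *:%R (Complex 0 (-1))) \o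
      (fun z : HC => Complex 0 1 *: z - complex_extension A z)).
    by apply: isomorphism_comp iA; apply: isomorphism_scale; rewrite imaginary_neq0 ?oppr_eq0 ?oner_eq0.
  apply/funext => z; rewrite /= -oppr_imaginary.
  by rewrite scaleNr scalerBr scalerA i2 scaleN1r opprB opprK addrC.
rewrite (_ : (fun z => _) = ( *:%R (Complex 0 1)) \o
    (fun z : HC => z + Complex 0 1 *: complex_extension A z)).
  by apply: isomorphism_comp iA; apply: isomorphism_scale; rewrite imaginary_neq0 ?oppr_eq0 ?oner_eq0.
by apply/funext => z /=; rewrite scalerDr scalerA i2 scaleN1r.
Qed.

Lemma cplx_graphE (A : H -> H) x : linear A ->
  cplx x (A x) = (cplx x 0 : HC) + Complex 0 1 *: complex_extension A (cplx x 0).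
Proof.
move=> lA; congr (_, _) => /=.
  by rewrite (linear_ap0 lA) !scaler0 scale0r subrr addr0.
by rewrite (linear_ap0 lA) !scaler0 scale1r !add0r.
Qed.

(** The isomorphism condition does not mention [f]; this is what makes one good Riesz basis as
    strong as all of them. *)
Lemma graph_riesz_basis (A : H -> H) D (f : nat -> H) : bounded_operator A ->
  riesz_basis D f ->
  riesz_basis D (fun n => cplx (f n) (A (f n)) : HC) <->
  isomorphism (fun z : HC => z + Complex 0 1 *: complex_extension A z).
Proof.
move=> bA [e [U [oe iU fE]]].
have oeC := cplx_orthonormal_basis oe.
have iUC := complex_extension_isomorphism iU.
set T := (X in isomorphism X).
have TU n : D n -> cplx (f n) (A (f n)) = T (complex_extension U (cplx (e n) 0)).
  move=> Dn; rewrite cplx_graphE ?fE//; last exact: bA.1.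
  by rewrite /T /complex_extension /= (linear_ap0 iU.1.1).
split=> [[e' [W [oe' iW fW]]]|iT]; last first.
  exists (fun n => cplx (e n) 0), (T \o complex_extension U); split=> //.
  exact: isomorphism_comp.
have [_ [UC' [bUC' UCK UC'K]]] := iUC.
have [bW [W' [bW' WK W'K]]] := iW.
have bT : bounded_operator T.
  have bC := complex_extension_bounded_operator bA.
  split=> [a z w|].
    by rewrite /T bC.1 !scalerDr !scalerA [in RHS](mulrC a) addrACA.
  have [M M0 CM] := bounded_operator_gt0 bC.
  exists (1 + `|Complex 0 1| * M) => z; apply: le_trans (ler_normD _ _) _.
  by rewrite normrZ mulrDl mul1r lerD2l -mulrA ler_wpM2l.
have iV : isomorphism (W' \o (T \o complex_extension U)).
  apply: (orthonormal_bases_isomorphism oeC oe').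
    by do 2 apply: bounded_operator_comp => //; exact: iUC.1.
  by move=> n Dn; rewrite /= -TU// fW// WK.
have -> : T = (W \o (W' \o (T \o complex_extension U))) \o UC'.
  by apply/funext => z /=; rewrite W'K UC'K.
apply: isomorphism_comp; first exact: isomorphism_comp.
by split=> //; exists (complex_extension U); split=> //; exact: iUC.1.
Qed.

End Graph.

Lemma resolvent_setE (K : numFieldType) (X : normedModType K) (T : X -> X) l :
  resolvent_set T l <-> isomorphism (fun x => l *: x - T x).
Proof. by split=> [/contrapT|iT]; [|exact]. Qed.

Theorem theorem2p3 (R : realType) (H : realHilbertType R) (A : H -> H)
    (sepH : separable_space H) (isoA : isomorphism A) :
  [<->
    exists f : nat -> H, riesz_basis (index_set H) f /\
      riesz_basis (index_set H) (fun n => cplx (f n) (A (f n)));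
    forall f : nat -> H, riesz_basis (index_set H) f ->
      riesz_basis (index_set H) (fun n => cplx (f n) (A (f n)));
    resolvent_set (complex_extension A) 'i%C;
    resolvent_set (complex_extension (adjoint A)) (- 'i%C)
  ].
Proof.
have bA := isoA.1; have bA' := bounded_operator_adjoint bA.
have [e oe] := separable_orthonormal_basis sepH.
(* With [U] the identity, [e] is the basis to which (ii) gets applied and which witnesses (i). *)
have rbe : riesz_basis (index_set H) e.
  exists e, id; split=> //; split; last by exists id; split=> //; split=> //;
    exists 1 => x; rewrite mul1r.
  by split=> //; exists 1 => x; rewrite mul1r.
have sqrD1 : resolvent_set (complex_extension A) 'i%C <->
    isomorphism (fun x => x + A (A x)).
  by apply: (iff_trans (resolvent_setE _ _)); apply: isomorphism_resolvent; rewrite ?mulr1.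
have sqrD1' : resolvent_set (complex_extension (adjoint A)) (- 'i%C) <->
    isomorphism (fun x => x + adjoint A (adjoint A x)).
  rewrite oppr_imaginary; apply: (iff_trans (resolvent_setE _ _)).
  (* Here [ep = -1], whereas [sqrD1] used [ep = 1]. *)
  by apply: isomorphism_resolvent; rewrite ?mulrNN ?mulr1.
have graph f : riesz_basis (index_set H) f ->
    riesz_basis (index_set H) (fun n => cplx (f n) (A (f n))) <->
    resolvent_set (complex_extension A) 'i%C.
  move=> rbf; have rbT := graph_riesz_basis bA rbf.
  split=> [/rbT/isomorphism_1Di/resolvent_setE //|].
  by move=> /resolvent_setE/isomorphism_1Di/rbT.
tfae.
- by move=> [f [rbf /(graph f rbf).1 iA]] g rbg; exact/(graph g rbg).
- by move=> /(_ e rbe)/(graph e rbe).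
- by move=> /sqrD1 iA; apply/sqrD1'; exact: isomorphism_adjoint_sqrD1.
- move=> /sqrD1' iA; exists e; split=> //; apply/(graph e rbe)/sqrD1.
  by rewrite -(adjointK bA); exact: isomorphism_adjoint_sqrD1.
Qed.
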